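(* If $(R,\mathfrak m)$ is a local ring of finite embedding dimension, then its completion $\widehat R$ is a complete Noetherian local ring with maximal ideal $\mathfrak m\widehat R$.
   Context: A local ring is a (not necessarily Noetherian) commutative ring with a unique maximal ideal; its embedding dimension is the minimal number of generators of its maximal ideal. The completion $\widehat R$ is the inverse limit of the rings $R/\mathfrak m^n$. *)

(* Defs.v *)
From HB Require Import structures.
From mathcomp Require Import all_boot all_algebra.
From mathcomp Require Import boolp.
Set Implicit Arguments. Unset Strict Implicit. Unset Printing Implicit Defensive.
Import GRing.Theory.
Local Open Scope ring_scope.
Local Open Scope quotient_scope.

(* Ideals are boolean predicates, as in ring_quotient.v; `[< _ >] makes an     *)
(* arbitrary proposition boolean, so every ideal is covered.  The type         *)
(* idealr A of ring_quotient.v is that of the PROPER ideals of A.              *)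

Section Ideals.
Variable A : comNzRingType.
Implicit Types (S : {pred A}) (I J : idealr A).

Definition ideal_gen S : {pred A} := fun x =>
  `[< exists2 s : seq (A * A),
        all (fun p => p.2 \in S) s & x = \sum_(p <- s) p.1 * p.2 >].

Definition maximal_ideal I : Prop :=
  forall J, {subset I <= J} -> J =i I.

Definition local_ring I : Prop :=
  maximal_ideal I /\ forall J, maximal_ideal J -> J =i I.

(* The unit ideal, not of type idealr A, is always generated by 1.             *)
Definition noetherian : Prop :=
  forall I, exists s : seq A, I =i ideal_gen (mem s).

Definition embedding_dimension I (d : nat) : Prop :=
  (exists2 s : seq A, size s = d & I =i ideal_gen (mem s)) /\
  (forall s : seq A, I =i ideal_gen (mem s) -> (d <= size s)%N).

Definition finite_embedding_dimension I : Prop :=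
  exists d, embedding_dimension I d.

Lemma ideal_gen_in S x : x \in S -> x \in ideal_gen S.
Proof.
move=> xS; apply/asboolP; exists [:: (1, x)]; first by rewrite /= xS.
by rewrite big_seq1 mul1r.
Qed.

Lemma ideal_gen_lin S a :
  {in ideal_gen S &, forall u v, a * u + v \in ideal_gen S}.
Proof.
move=> u v /asboolP[s sS ->] /asboolP[t tS ->]; apply/asboolP.
exists ([seq (a * p.1, p.2) | p <- s] ++ t).
  by rewrite all_cat tS andbT all_map.
rewrite big_cat big_map mulr_sumr; congr (_ + _).
by apply: eq_bigr => p _; rewrite mulrA.
Qed.

Lemma ideal_gen0 S : 0 \in ideal_gen S.
Proof. by apply/asboolP; exists [::]; rewrite ?big_nil. Qed.

Lemma ideal_gen_sub S I : {subset S <= I} -> {subset ideal_gen S <= I}.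
Proof.
move=> SI x /asboolP[s sS ->]; rewrite big_seq; apply: rpred_sum => p ps.
by apply: idealMr; apply: SI; apply: (allP sS).
Qed.

Definition ideal_exp I (n : nat) : {pred A} :=
  ideal_gen (fun x =>
    `[< exists2 s : n.-tuple A, all (mem I) s & x = \prod_(a <- s) a >]).

Lemma ideal_expSS I n : {subset ideal_exp I n.+2 <= ideal_exp I n.+1}.
Proof.
move=> x /asboolP[s sS ->]; rewrite big_seq.
apply: (big_ind (fun y => y \in ideal_exp I n.+1)) => [|y z hy hz|p ps].
- exact: ideal_gen0.
- by rewrite -[y]mul1r; apply: ideal_gen_lin.
have /asboolP[t tI ->] := allP sS p ps.
case/tupleP: t tI => a t /= /andP[aI tI].
rewrite big_cons mulrA -[_ * _]addr0; apply: ideal_gen_lin; last exact: ideal_gen0.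
by apply: ideal_gen_in; apply/asboolP; exists t.
Qed.

Lemma ideal_exp_sub I n : {subset ideal_exp I n.+1 <= I}.
Proof.
apply: ideal_gen_sub => x /asboolP[t tI ->].
case/tupleP: t tI => a t /= /andP[aI _].
by rewrite big_cons mulrC; apply: idealMr.
Qed.

Lemma ideal_exp_idealr_closed I n : idealr_closed (ideal_exp I n.+1).
Proof.
split; [exact: ideal_gen0| |exact: ideal_gen_lin].
by apply: contraFN (idealr1 I); apply: ideal_exp_sub.
Qed.

HB.instance Definition _ I n :=
  isIdealr.Build A (ideal_exp I n.+1) (ideal_exp_idealr_closed I n).

End Ideals.

Section Completion.
Variables (A : comNzRingType) (I : idealr A).

(* The index is shifted by one: the term A / I ^ 0 of the system, the zero     *)
(* ring, is left out because rings here are nontrivial; the limit is the same. *)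
Definition quot_exp (n : nat) : comNzRingType :=
  {ideal_quot (ideal_exp I n.+1 : idealr A)}.

Definition quot_exp_pi n (x : A) : quot_exp n :=
  \pi_{ideal_quot (ideal_exp I n.+1 : idealr A)} x.

Definition quot_exp_trans n (y : quot_exp n.+1) : quot_exp n :=
  quot_exp_pi n (repr (y : {ideal_quot (ideal_exp I n.+2 : idealr A)})).

Lemma quot_exp_piP n x y :
  (quot_exp_pi n x = quot_exp_pi n y) <-> (x - y \in ideal_exp I n.+1).
Proof. by rewrite Quotient.idealrBE; split=> [/eqP|/eqP]. Qed.

Lemma quot_exp_pi_surj n (y : quot_exp n) : exists x, y = quot_exp_pi n x.
Proof. by exists (repr (y : {ideal_quot _})); rewrite /quot_exp_pi reprK. Qed.

Lemma quot_exp_pi_zmod_morphism n : zmod_morphism (quot_exp_pi n).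
Proof. exact: raddfB. Qed.

Lemma quot_exp_pi_monoid_morphism n : monoid_morphism (quot_exp_pi n).
Proof. by split; [exact: rmorph1|exact: rmorphM]. Qed.

HB.instance Definition _ n :=
  GRing.isZmodMorphism.Build A (quot_exp n) (quot_exp_pi n)
    (quot_exp_pi_zmod_morphism n).
HB.instance Definition _ n :=
  GRing.isMonoidMorphism.Build A (quot_exp n) (quot_exp_pi n)
    (quot_exp_pi_monoid_morphism n).

Lemma quot_exp_trans_pi n x :
  quot_exp_trans (quot_exp_pi n.+1 x) = quot_exp_pi n x.
Proof.
apply/quot_exp_piP/ideal_expSS; apply/quot_exp_piP.
by rewrite /quot_exp_pi reprK.
Qed.

Lemma quot_exp_trans_zmod_morphism n : zmod_morphism (@quot_exp_trans n).
Proof.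
move=> y z; have [a ->] := quot_exp_pi_surj y; have [b ->] := quot_exp_pi_surj z.
by rewrite -rmorphB !quot_exp_trans_pi rmorphB.
Qed.

Lemma quot_exp_trans_monoid_morphism n : monoid_morphism (@quot_exp_trans n).
Proof.
split; first by rewrite -(rmorph1 (quot_exp_pi n.+1)) quot_exp_trans_pi rmorph1.
move=> y z; have [a ->] := quot_exp_pi_surj y; have [b ->] := quot_exp_pi_surj z.
by rewrite -rmorphM !quot_exp_trans_pi rmorphM.
Qed.

HB.instance Definition _ n :=
  GRing.isZmodMorphism.Build (quot_exp n.+1) (quot_exp n) (@quot_exp_trans n)
    (@quot_exp_trans_zmod_morphism n).
HB.instance Definition _ n :=
  GRing.isMonoidMorphism.Build (quot_exp n.+1) (quot_exp n) (@quot_exp_trans n)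
    (@quot_exp_trans_monoid_morphism n).

Record completion : Type := Completion {
  completion_proj : forall n, quot_exp n;
  completion_projP : forall n,
    quot_exp_trans (completion_proj n.+1) = completion_proj n }.

Implicit Types x y z : completion.

Lemma completion_eq x y :
  (forall n, completion_proj x n = completion_proj y n) -> x = y.
Proof.
case: x y => [x xP] [y yP] /= xy.
have e : x = y by apply: functional_extensionality_dep.
by case: _ / e yP {xy} => yP; congr Completion; apply: Prop_irrelevance.
Qed.

HB.instance Definition _ := gen_eqMixin completion.
HB.instance Definition _ := gen_choiceMixin completion.

Definition completion_zero : completion :=
  @Completion (fun=> 0) (fun=> rmorph0 _).
Definition completion_one : completion :=
  @Completion (fun=> 1) (fun=> rmorph1 _).

Lemma completion_oppP x n :
  quot_exp_trans (- completion_proj x n.+1) = - completion_proj x n.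
Proof. by rewrite rmorphN /= !completion_projP. Qed.
Definition completion_opp x := Completion (completion_oppP x).

Lemma completion_addP x y n :
  quot_exp_trans (completion_proj x n.+1 + completion_proj y n.+1) =
  completion_proj x n + completion_proj y n.
Proof. by rewrite rmorphD /= !completion_projP. Qed.
Definition completion_add x y := Completion (completion_addP x y).

Lemma completion_mulP x y n :
  quot_exp_trans (completion_proj x n.+1 * completion_proj y n.+1) =
  completion_proj x n * completion_proj y n.
Proof. by rewrite rmorphM /= !completion_projP. Qed.
Definition completion_mul x y := Completion (completion_mulP x y).

Fact completion_addA : associative completion_add.
Proof. by move=> x y z; apply: completion_eq => n; apply: addrA. Qed.
Fact completion_addC : commutative completion_add.
Proof. by move=> x y; apply: completion_eq => n; apply: addrC. Qed.
Fact completion_add0 : left_id completion_zero completion_add.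
Proof. by move=> x; apply: completion_eq => n; apply: add0r. Qed.
Fact completion_addN : left_inverse completion_zero completion_opp completion_add.
Proof. by move=> x; apply: completion_eq => n; apply: addNr. Qed.

HB.instance Definition _ := GRing.isZmodule.Build completion
  completion_addA completion_addC completion_add0 completion_addN.

Fact completion_mulA : associative completion_mul.
Proof. by move=> x y z; apply: completion_eq => n; apply: mulrA. Qed.
Fact completion_mulC : commutative completion_mul.
Proof. by move=> x y; apply: completion_eq => n; apply: mulrC. Qed.
Fact completion_mul1 : left_id completion_one completion_mul.
Proof. by move=> x; apply: completion_eq => n; apply: mul1r. Qed.
Fact completion_mulDl : left_distributive completion_mul +%R.
Proof. by move=> x y z; apply: completion_eq => n; apply: mulrDl. Qed.
Fact completion_one_neq0 : completion_one != 0.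
Proof.
apply/eqP => /(congr1 (fun x => completion_proj x 0)) /= /eqP.
by rewrite oner_eq0.
Qed.

HB.instance Definition _ := GRing.Zmodule_isComNzRing.Build completion
  completion_mulA completion_mulC completion_mul1 completion_mulDl
  completion_one_neq0.

Definition to_completion (a : A) : completion :=
  @Completion (fun n => quot_exp_pi n a) (fun n => quot_exp_trans_pi n a).

Fact to_completion_zmod_morphism : zmod_morphism to_completion.
Proof. by move=> a b; apply: completion_eq => n; apply: rmorphB. Qed.
Fact to_completion_monoid_morphism : monoid_morphism to_completion.
Proof.
split; first by apply: completion_eq => n; apply: rmorph1.
by move=> a b; apply: completion_eq => n; apply: rmorphM.
Qed.
HB.instance Definition _ := GRing.isZmodMorphism.Build A completion
  to_completion to_completion_zmod_morphism.
HB.instance Definition _ := GRing.isMonoidMorphism.Build A completion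
  to_completion to_completion_monoid_morphism.

(* The ring morphism to_completion is then an isomorphism; injectivity says    *)
(* that A is I-adically separated, surjectivity that Cauchy sequences converge.*)
Definition adically_complete : Prop := bijective to_completion.

End Completion.

(* The ideal I B of B, for a ring morphism f : A -> B.                         *)
Definition ideal_ext (A B : comNzRingType) (f : {rmorphism A -> B})
    (I : {pred A}) : {pred B} :=
  ideal_gen (fun y => `[< exists2 x, x \in I & y = f x >]).

(* Main.v *)
(* Let F n be the kernel of the projection of the completion C onto R / m^n.   *)
(* C is complete and separated for F, so successive approximation lifts        *)
(* generation modulo F (n + 1) to generation in C: F n is generated by the     *)
(* degree n monomials X^a in the generators of m, hence F n = (m C)^n, which   *)
(* makes C complete and m C = F 1.  An element y off F 1 has a multiple        *)
(* 1 - t with t in F 1, inverted by the geometric series, so C is local.       *)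
(* For Noetherianity, attach to an ideal J the exponents a such that J         *)
(* contains X^a + (higher monomials for the degree-lexicographic order).       *)
(* By Dickson's lemma finitely many of them, realized by f_1, .., f_k in J,    *)
(* divide all others; as elements off F 1 are units, division by the f_i       *)
(* reduces any y in J to higher and higher order, so the f_i generate J.       *)
From HB Require Import structures.
Require Import Defs.
From mathcomp Require Import all_boot all_order all_algebra.
From mathcomp Require Import boolp mpoly ring.
Set Implicit Arguments. Unset Strict Implicit. Unset Printing Implicit Defensive.
Import Order.TTheory GRing.Theory.
Local Open Scope ring_scope.

(** One convergence argument, [fil_lift], carries both finiteness results: if elements of order n
    can be corrected up to order n + 1 by combinations of fixed generators, with coefficients whose
    order grows with n, the corrections sum to an exact combination. With the monomials of degree n
    as generators it gives [fil_gen], hence [fil_ideal_ext] and [fil_ideal_exp]; the latter turns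
    completeness for [fil] ([fil_limit], [fil_separated]) into [fil_adically_complete]. With the
    finitely many elements of J selected by [dickson], a standard basis of J, it gives
    [completion_noetherian]. The units needed for locality and for division come from [fil_inv]. *)

(** * Dickson's lemma *)

Lemma nondecreasing_subsequence (u : nat -> nat) :
  exists2 f : nat -> nat, {homo f : i j / (i < j)%N} &
    {homo u \o f : i j / (i <= j)%N}.
Proof.
(* Minima over shrinking tails of [u] can only grow, so the indices attaining them give the
   subsequence. *)
have argmin N : exists i, (N <= i)%N /\ forall j, (N <= j)%N -> (u i <= u j)%N.
  pose P v := `[< exists2 i, (N <= i)%N & u i = v >].
  have exP : exists v, P v by exists (u N); apply/asboolP; exists N.
  case: (ex_minnP exP) => v /asboolP[i Ni <-] vmin; exists i; split=> // j Nj.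
  by apply: vmin; apply/asboolP; exists j.
have [g gP] := choice argmin.
pose f := fix f n := if n is k.+1 then g (f k).+1 else g 0%N.
exists f.
  by apply: homo_ltn => [? ? ?|i]; [exact: ltn_trans|exact: (gP _).1].
apply: homo_leq => [//|? ? ?|[|i]]; first exact: leq_trans.
  exact: (gP 0%N).2.
by apply: (gP _).2; apply: leq_trans (ltnW (gP _).1); apply: (gP _).1.
Qed.

Lemma nondecreasing_subsequences k (u : nat -> nat -> nat) :
  exists2 f : nat -> nat, {homo f : i j / (i < j)%N} &
    forall c, (c < k)%N -> {homo (fun i => u (f i) c) : i j / (i <= j)%N}.
Proof.
elim: k => [|k [f f_incr fP]]; first by exists id.
have [g g_incr gP] := nondecreasing_subsequence (fun i => u (f i) k).
exists (f \o g) => [i j ij|c]; first exact/f_incr/g_incr.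
rewrite ltnS leq_eqVlt => /predU1P[->|ck]; first exact: gP.
move=> i j ij; apply: fP => //.
by move: ij; rewrite leq_eqVlt => /predU1P[->//|/g_incr/ltnW].
Qed.

(** Otherwise every finite part of [L] leaves out an element of [L] that none of its members
    divides. Iterating gives an infinite sequence in which no term divides a later one,
    contradicting a subsequence nondecreasing in every exponent. *)
Lemma dickson d (L : 'X_{1..d} -> Prop) :
  exists2 l : seq 'X_{1..d}, (forall a, a \in l -> L a) &
    forall a, L a -> exists2 b, b \in l & (b <= a)%MM.
Proof.
apply: contrapT => noL.
have next (l : seq 'X_{1..d}) : exists a, (forall b, b \in l -> L b) ->
    L a /\ forall b, b \in l -> ~~ (b <= a)%MM.
  apply: contrapT => nol; apply: noL; exists l.
    move=> a al; apply: contrapT => La; apply: nol; exists a => lL.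
    by case: La; apply: lL.
  move=> a La; apply: contrapT => na; apply: nol; exists a => _; split=> // b bl.
  by apply/negP => ba; apply: na; exists b.
have [g gP] := choice next.
pose s := fix s n := if n is k.+1 then g (s k) :: s k else [::].
have sL n : forall b, b \in s n -> L b.
  elim: n => //= n IH b; rewrite inE => /predU1P[->|/IH//].
  exact: (gP _ IH).1.
have s_mem i j : (i < j)%N -> g (s i) \in s j.
  elim: j => //= j IH; rewrite ltnS leq_eqVlt inE => /predU1P[->|/IH->].
    by rewrite eqxx.
  by rewrite orbT.
have [f f_incr fP] := nondecreasing_subsequences d (fun i c => nth 0%N (g (s i)) c).
have /negP := (gP _ (@sL (f 1%N))).2 _ (s_mem _ _ (f_incr _ _ (ltn0Sn 0))).
apply; apply/mnm_lepP => i; rewrite !(mnm_nth 0%N).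
exact: (fP i (ltn_ord i) 0%N 1%N).
Qed.

(** * Monomials of a given degree *)

Lemma mnm_split d n (a : 'X_{1..d}) : (n <= mdeg a)%N ->
  exists b c, a = (b + c)%MM /\ mdeg b = n.
Proof.
elim: n => [|n IH] na; first by exists 0%MM, a; rewrite add0m mdeg0.
have [b [c [ac bn]]] := IH (ltnW na).
have c0 : c != 0%MM.
  by apply: contraL na => /eqP c0; rewrite ac c0 addm0 bn ltnn.
have [i ci] : exists i, c i != 0%N.
  apply: contrapT => ci; move/eqP: c0; apply; apply/mnmP => i; rewrite mnm0E.
  by apply: contrapT => /eqP ci0; apply: ci; exists i.
exists (b + U_(i))%MM, (c - U_(i))%MM; rewrite mdegD mdeg1 addn1 bn; split=> //.
by rewrite -addmA [(U_(i) + _)%MM]addmC submK // lep1mP.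
Qed.

(** Sorted so that the division in [completion_noetherian] can cancel the smallest monomial
    first. *)
Definition monomials d n : seq 'X_{1..d} :=
  sort <=%O [seq bmnm b | b : 'X_{1..d < n.+1} <- enum predT & mdeg b == n].

Lemma mem_monomials d n (a : 'X_{1..d}) : (a \in monomials d n) = (mdeg a == n).
Proof.
rewrite mem_sort; apply/mapP/idP => [[b + ->]|an].
  by rewrite mem_filter => /andP[].
have an1 : (mdeg a < n.+1)%N by rewrite (eqP an).
by exists (BMultinom an1); rewrite // mem_filter an mem_enum.
Qed.

Lemma sorted_monomials d n : sorted <%O (monomials d n).
Proof.
rewrite sort_lt_sorted map_inj_uniq => [|b c]; last exact: val_inj.
exact/filter_uniq/enum_uniq.
Qed.

(** * Generated ideals, their powers, and inverses modulo a maximal ideal *)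

Section IdealGen.
Variable A : comNzRingType.
Implicit Types (S T U : {pred A}) (g : seq A) (I : idealr A).

Lemma ideal_gen_zmod_closed S : zmod_closed (ideal_gen S).
Proof.
split=> [|x y xS yS]; first exact: ideal_gen0.
by rewrite addrC -mulN1r; apply: ideal_gen_lin.
Qed.
HB.instance Definition _ S :=
  GRing.isZmodClosed.Build A (ideal_gen S) (ideal_gen_zmod_closed S).

Lemma ideal_genMr S a x : x \in ideal_gen S -> a * x \in ideal_gen S.
Proof. by move=> xS; rewrite -[a * x]addr0 ideal_gen_lin ?rpred0. Qed.

Lemma ideal_gen_min S (P : zmodClosed A) : (forall a x, x \in S -> a * x \in P) ->
  {subset ideal_gen S <= P}.
Proof.
move=> SP _ /asboolP[s sS ->]; rewrite big_seq; apply: rpred_sum => p ps.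
by apply: SP; apply: (allP sS).
Qed.

Lemma ideal_gen_mono S T : {subset S <= ideal_gen T} ->
  {subset ideal_gen S <= ideal_gen T}.
Proof. by move=> ST; apply: ideal_gen_min => a x xS; apply/ideal_genMr/ST. Qed.

Lemma ideal_gen_mul S T U :
  {in S & T, forall x y, x * y \in ideal_gen U} ->
  {in ideal_gen S & ideal_gen T, forall x y, x * y \in ideal_gen U}.
Proof.
move=> STU x y /asboolP[s sS ->] /asboolP[t tT ->].
rewrite mulr_suml big_seq; apply: rpred_sum => p ps.
rewrite mulr_sumr big_seq; apply: rpred_sum => q qt.
by rewrite mulrACA; apply/ideal_genMr/STU; [apply: (allP sS)|apply: (allP tT)].
Qed.

Lemma ideal_gen_nil x : x \in ideal_gen (mem ([::] : seq A)) -> x = 0.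
Proof. by case/asboolP => -[|p s] //= _ ->; rewrite big_nil. Qed.

Lemma ideal_gen_cons y g x : x \in ideal_gen (mem (y :: g)) ->
  exists a, x - a * y \in ideal_gen (mem g).
Proof.
case/asboolP=> s + ->; elim: s => [|p s IH] /=.
  by exists 0; rewrite big_nil mul0r subr0 rpred0.
case/andP => pg /IH[a ag]; rewrite big_cons.
have [->|py] := eqVneq p.2 y.
  by exists (p.1 + a); rewrite mulrDl opprD addrACA subrr add0r.
exists a; rewrite -addrA rpredD //; apply/ideal_genMr/ideal_gen_in.
by move: pg; rewrite inE (negPf py).
Qed.

(** One coefficient per position of [g], unlike the free list of pairs in [ideal_gen], so that
    successive corrections can be summed generator by generator. *)
Definition lincomb (P : {pred A}) g (z : A) :=
  exists2 c : nat -> A, forall i, c i \in P & z = \sum_(i < size g) c i * g`_i.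

Section Lincomb.
Variables (P : zmodClosed A) (g : seq A).

Lemma lincomb0 : lincomb P g 0.
Proof. by exists (fun=> 0) => [i|]; rewrite ?rpred0 // big1 // => i _; rewrite mul0r. Qed.

Lemma lincombD y z : lincomb P g y -> lincomb P g z -> lincomb P g (y + z).
Proof.
case=> b bP -> [c cP ->]; exists (fun i => b i + c i) => [i|]; first exact: rpredD.
by rewrite -big_split; apply: eq_bigr => i _; rewrite mulrDl.
Qed.

Lemma lincomb_mem a x : a \in P -> x \in g -> lincomb P g (a * x).
Proof.
move=> aP xg; have xi : (index x g < size g)%N by rewrite index_mem.
exists (fun i => if i == index x g then a else 0) => [i|].
  by case: ifP; rewrite ?rpred0.
rewrite (bigD1 (Ordinal xi)) //= eqxx nth_index // big1 ?addr0 // => i.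
by rewrite -val_eqE /= => /negPf ->; rewrite mul0r.
Qed.

End Lincomb.

Lemma lincomb_ideal_gen P g z : lincomb P g z -> z \in ideal_gen (mem g).
Proof.
case=> c _ ->; apply: rpred_sum => i _.
by apply/ideal_genMr/ideal_gen_in/mem_nth.
Qed.

Lemma ideal_exp0 I x : x \in ideal_exp I 0.
Proof.
rewrite -[x]mulr1; apply/ideal_genMr/ideal_gen_in/asboolP.
by exists [tuple]; rewrite ?big_nil.
Qed.

Lemma ideal_exp1 I : {subset I <= ideal_exp I 1}.
Proof.
move=> x xI; apply/ideal_gen_in/asboolP.
by exists [tuple x]; rewrite /= ?xI // big_seq1.
Qed.

Lemma ideal_expM I a b :
  {in ideal_exp I a & ideal_exp I b, forall x y, x * y \in ideal_exp I (a + b)}.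
Proof.
apply: ideal_gen_mul => x y /asboolP[s sI ->] /asboolP[t tI ->].
apply/ideal_gen_in/asboolP; exists [tuple of s ++ t]; last by rewrite big_cat.
by rewrite /= all_cat sI.
Qed.

Lemma mmap1D d (h : 'I_d -> A) a b : mmap1 h (a + b)%MM = mmap1 h a * mmap1 h b.
Proof. by apply: commr_mmap1_M => i x; apply: mulrC. Qed.

(** Stated for any multiplicative family because it serves both [fil] and the powers of [fil 1]. *)
Lemma mmap1_filtration (G : nat -> {pred A}) d (h : 'I_d -> A) a :
  1 \in G 0%N ->
  (forall i j, {in G i & G j, forall x y, x * y \in G (i + j)%N}) ->
  (forall i, h i \in G 1%N) -> mmap1 h a \in G (mdeg a).
Proof.
move=> G1 GM hG; rewrite mdegE /mmap1.
elim/big_rec2: _ => // i n x _ xG; apply: (GM) => //.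
by elim: (a i) => [|k IH] //; rewrite exprS -add1n GM.
Qed.

Lemma ideal_exp_monomials I (s : seq A) n : I =i ideal_gen (mem s) ->
  {subset ideal_exp I n <= ideal_gen (mem
     [seq mmap1 (fun i : 'I_(size s) => s`_i) a | a <- monomials (size s) n])}.
Proof.
move=> Is; apply: ideal_gen_mono => _ /asboolP[t tI ->].
elim: n t tI => [|n IH] t.
  move=> _; rewrite tuple0 big_nil; apply/ideal_gen_in/mapP.
  by exists 0%MM; rewrite ?mmap11 // mem_monomials mdeg0.
case/tupleP: t => x t /= /andP[xI /IH ts]; rewrite big_cons.
have xs : x \in ideal_gen (mem s) by rewrite -Is.
apply: ideal_gen_mul xs ts => _ _ /(nthP 0)[i si <-] /mapP[a + ->].
rewrite mem_monomials => /eqP an; apply/ideal_gen_in/mapP.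
exists (U_(Ordinal si) + a)%MM; last by rewrite mmap1D mmap1U.
by rewrite mem_monomials mdegD mdeg1 an.
Qed.

Lemma maximal_ideal_inv I r : maximal_ideal I -> r \notin I ->
  exists b, 1 - b * r \in I.
Proof.
move=> Imax rI; apply: contrapT => no_inv.
(* This is I + (r). By [no_inv] it omits 1, so it is a proper ideal, as [idealr] demands. *)
pose J : {pred A} := fun x => `[< exists b, x - b * r \in I >].
have Jcl : idealr_closed J.
  split; first by apply/asboolP; exists 0; rewrite mul0r subr0 rpred0.
    by apply/asboolP.
  move=> a u v /asboolP[b bI] /asboolP[c cI]; apply/asboolP; exists (a * b + c).
  by rewrite mulrDl opprD addrACA -mulrA -mulrBr rpredD ?idealMr.
pose Ji : idealr A := HB.pack J (isIdealr.Build A J Jcl).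
move/negP: rI; apply; rewrite -(Imax Ji) => [|x xI].
  by apply/asboolP; exists 1; rewrite mul1r subrr rpred0.
by apply/asboolP; exists 0; rewrite mul0r subr0.
Qed.

End IdealGen.

(** * The filtration of the completion: convergence, lifting, locality *)

Section Filtration.
Variables (A : comNzRingType) (I : idealr A).
Implicit Types (y z : completion I) (n k : nat).
Local Notation iota := (to_completion I).

Lemma quot_exp_pi_eq0 n r : quot_exp_pi I n r = 0 <-> r \in ideal_exp I n.+1.
Proof. by rewrite -(rmorph0 (quot_exp_pi I n)) -{2}[r]subr0; apply: quot_exp_piP. Qed.

Lemma completion_proj_le y n k r : (n <= k)%N ->
  completion_proj y k = quot_exp_pi I k r -> completion_proj y n = quot_exp_pi I n r.
Proof.
move=> /subnK <-; elim: (k - n)%N => //= j IH yr; apply: IH.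
by rewrite -completion_projP -quot_exp_trans_pi -yr.
Qed.

(* The kernel of the projection to A / I ^ n, in unshifted indexing.           *)
Definition fil n : {pred completion I} :=
  fun y => if n is k.+1 then completion_proj y k == 0 else true.

Lemma fil_zmod_closed n : zmod_closed (fil n).
Proof.
case: n => [|n]; split=> //; first exact/eqP.
by move=> y z /eqP yn /eqP zn; apply/eqP; rewrite /= yn zn subr0.
Qed.
HB.instance Definition _ n :=
  GRing.isZmodClosed.Build (completion I) (fil n) (fil_zmod_closed n).

Lemma filMr n y z : z \in fil n -> y * z \in fil n.
Proof. by case: n => // n /eqP zn; apply/eqP; rewrite /= zn mulr0. Qed.

Lemma fil_idealr_closed n : idealr_closed (fil n.+1).
Proof.
split=> [||y u v uF vF]; [exact: rpred0|exact: oner_neq0|].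
by rewrite rpredD ?filMr.
Qed.
HB.instance Definition _ n :=
  isIdealr.Build (completion I) (fil n.+1) (fil_idealr_closed n).

Lemma fil_proj n k y r : (n <= k.+1)%N -> y \in fil n ->
  completion_proj y k = quot_exp_pi I k r -> r \in ideal_exp I n.
Proof.
case: n => [|n] nk; first by rewrite ideal_exp0.
move=> /eqP yn /(completion_proj_le (nk : (n <= k)%N)).
by rewrite yn => /esym/quot_exp_pi_eq0.
Qed.

Lemma filP n y r : y - iota r \in fil n.+1 <->
  completion_proj y n = quot_exp_pi I n r.
Proof.
split=> [/eqP yr|yr]; first by apply/eqP; rewrite -subr_eq0; apply/eqP.
by apply/eqP; rewrite /= yr subrr.
Qed.

Lemma fil_iota n r : r \in ideal_exp I n -> iota r \in fil n.
Proof. by case: n => // n rI; apply/eqP/quot_exp_pi_eq0. Qed.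

Lemma fil_le n k : (n <= k)%N -> {subset fil k <= fil n}.
Proof.
case: n k => [|n] [|k] // nk y /eqP yk; apply/eqP.
by rewrite (@completion_proj_le y n k 0 nk) ?rmorph0.
Qed.

Lemma filM n k : {in fil n & fil k, forall y z, y * z \in fil (n + k)}.
Proof.
move=> y z yn zk; case E: (n + k)%N => [|j] //; apply/eqP.
have [r yr] := quot_exp_pi_surj (completion_proj y j).
have [s zs] := quot_exp_pi_surj (completion_proj z j).
rewrite /= yr zs -rmorphM; apply/quot_exp_pi_eq0; rewrite -E.
by apply: ideal_expM; [apply: fil_proj yr|apply: fil_proj zs];
  rewrite // -E ?leq_addr ?leq_addl.
Qed.

Lemma fil_separated y : (forall n, y \in fil n) -> y = 0.
Proof. by move=> y0; apply: completion_eq => n; apply/eqP/(y0 n.+1). Qed.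

Lemma fil_limit (u : nat -> completion I) :
  (forall n, u n.+1 - u n \in fil n) -> exists s, forall n, s - u n \in fil n.
Proof.
move=> uF.
(* Component n is constant from [u n.+1] on; these stable components form the limit. *)
have sP n : quot_exp_trans (completion_proj (u n.+2) n.+1) = completion_proj (u n.+1) n.
  rewrite completion_projP; apply/eqP; rewrite -subr_eq0; exact: (uF n.+1).
by exists (Completion sP) => -[|n] //; apply/eqP; rewrite /= subrr.
Qed.

Lemma fil_approx n y : y \in fil n ->
  exists2 r, r \in ideal_exp I n & y - iota r \in fil n.+1.
Proof.
have [r yr] := quot_exp_pi_surj (completion_proj y n) => yn.
by exists r; [apply: fil_proj yr|apply/filP].
Qed.

(* Successive approximation: the k-th corrections of the coefficients lie in   *)
(* fil (k - n0), so their series converge.                                     *)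
Lemma fil_lift (J : {pred completion I}) (g : seq (completion I)) n0 :
  (forall n y, y \in J -> y \in fil n -> exists z,
     [/\ lincomb (fil (n - n0)) g z, y - z \in J & y - z \in fil n.+1]) ->
  {subset J <= ideal_gen (mem g)}.
Proof.
move=> step y yJ.
(* [choice] needs a total function: zero coefficients are the default where [step] does not
   apply. *)
have stepc (x : nat * completion I) : exists c : nat -> completion I,
    x.2 \in J -> x.2 \in fil x.1 ->
    [/\ forall i, c i \in fil (x.1 - n0),
        x.2 - \sum_(i < size g) c i * g`_i \in J &
        x.2 - \sum_(i < size g) c i * g`_i \in fil x.1.+1].
  have [xJ|xJ] := boolP (x.2 \in J); last by exists (fun=> 0).
  have [xF|xF] := boolP (x.2 \in fil x.1); last by exists (fun=> 0).
  have [z [[c cF ->] zJ zF]] := step _ _ xJ xF.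
  by exists c.
have [c cP] := choice stepc.
(* [v n] is the remainder after n corrections. *)
pose v := fix v n := if n is k.+1
  then v k - \sum_(i < size g) c (k, v k) i * g`_i else y.
pose w n := c (n, v n).
have vP n : v n \in J /\ v n \in fil n.
  by elim: n => // n [vJ vF]; have [] := cP (n, v n) vJ vF.
have limP i : exists s, forall n, s - \sum_(k < n + n0) w k i \in fil n.
  (* The shift by [n0] makes the next term, [w (n + n0) i], lie in [fil n]. *)
  apply: (fil_limit (u := fun n => \sum_(k < n + n0) w k i)) => n.
  rewrite /= addSn big_ord_recr /= addrAC subrr add0r.
  by have [/(_ i) + _ _] := cP (n + n0, v (n + n0))%N (vP _).1 (vP _).2; rewrite /= addnK.
have [s sP] := choice limP.
have vE n : y = v n + \sum_(i < size g) (\sum_(k < n) w k i) * g`_i.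
  elim: n => [|n {1}->] /=.
    by rewrite big1 ?addr0 // => i _; rewrite big_ord0 mul0r.
  rewrite -addrA; congr (_ + _); rewrite -sumrN -big_split; apply: eq_bigr => i _.
  by rewrite -/(w n) big_ord_recr /= mulrDl [RHS]addrC addrK.
suff -> : y = \sum_(i < size g) s i * g`_i.
  by apply: (@lincomb_ideal_gen _ (fil 0)); exists s.
apply/eqP; rewrite -subr_eq0; apply/eqP/fil_separated => n.
rewrite (vE (n + n0)%N) -addrA rpredD //.
  by apply: fil_le (vP _).2; apply: leq_addr.
rewrite -sumrB; apply: rpred_sum => i _; rewrite -mulrBl mulrC filMr //.
by rewrite -opprB rpredN.
Qed.

Lemma fil_inv y : maximal_ideal I -> y \notin fil 1 -> exists z, z * y = 1.
Proof.
move=> Imax yF; have [r yr] := quot_exp_pi_surj (completion_proj y 0).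
have rI : r \notin I.
  apply: contra yF => /ideal_exp1 rI; apply/eqP; rewrite yr.
  exact/quot_exp_pi_eq0.
have [b br] := maximal_ideal_inv Imax rI.
(* The sum of the powers of [t] inverts 1 - t, a multiple of y. *)
pose t := 1 - iota b * y.
have tF : t \in fil 1.
  apply/eqP; rewrite /= yr -rmorphM -(rmorph1 (quot_exp_pi I 0)) -rmorphB.
  exact/quot_exp_pi_eq0/ideal_exp1.
have tnF n : t ^+ n \in fil n.
  by elim: n => // n IH; rewrite exprS -add1n filM.
have [|s sP] := @fil_limit (fun n => \sum_(i < n) t ^+ i) => [n|].
  by rewrite /= big_ord_recr /= addrAC subrr add0r.
exists (s * iota b); apply/eqP; rewrite -mulrA -subr_eq0; apply/eqP/fil_separated => n.
have -> : iota b * y = 1 - t by rewrite /t opprB addrC subrK.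
rewrite -[s](subrK (\sum_(i < n) t ^+ i)) mulrDl -addrA rpredD //.
  by rewrite mulrC filMr.
by rewrite -[1 - t]opprB mulrN [_ * (t - 1)]mulrC -subrX1 opprB addrC addKr rpredN.
Qed.

Lemma fil_local_ring : maximal_ideal I -> local_ring (fil 1 : idealr (completion I)).
Proof.
move=> Imax.
have sub_fil (J : idealr (completion I)) : {subset J <= fil 1}.
  move=> y yJ; apply: contraT => /(fil_inv Imax)[z zy].
  by rewrite -(idealr1 J) -zy idealMr.
split=> [J FJ y|J Jmax y]; first by apply/idP/idP => [/sub_fil|/FJ].
by rewrite -(Jmax (fil 1) (sub_fil J)).
Qed.

(** * Monomials in the generators: powers of the maximal ideal and completeness *)

Section Generators.
Variable s : seq A.
Hypothesis Is : I =i ideal_gen (mem s).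
Local Notation d := (size s).
Local Notation X a := (mmap1 (fun i : 'I_d => iota s`_i) a).

Lemma iota_mmap1 a : iota (mmap1 (fun i : 'I_d => s`_i) a) = X a.
Proof. by rewrite rmorph_prod; apply: eq_bigr => i _; rewrite rmorphXn. Qed.

Lemma generator_fil (i : 'I_d) : iota s`_i \in fil 1.
Proof. by apply/fil_iota/ideal_exp1; rewrite Is; apply/ideal_gen_in/mem_nth. Qed.

Lemma mmap1_fil a : X a \in fil (mdeg a).
Proof. by apply: mmap1_filtration => //; [exact: filM|exact: generator_fil]. Qed.

(** In order k >= n, the correction is a combination of monomials of degree k; each splits off a
    factor of degree n, and the cofactor of degree k - n puts the coefficient in [fil (k - n)].
    Below order n the zero correction suffices. *)
Lemma fil_gen n : {subset fil n <= ideal_gen (mem [seq X a | a <- monomials d n])}.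
Proof.
apply: (fil_lift (n0 := n)) => k y yn yk.
have [kn|nk] := ltnP k n.
  by exists 0; rewrite subr0; split=> //; [exact: lincomb0|exact: fil_le yn].
have [r rI rF] := fil_approx yk; exists (iota r); split=> //; last first.
  by rewrite rpredB //; apply: fil_le nk _ (fil_iota rI).
have /asboolP[t tX ->] := ideal_exp_monomials Is rI.
rewrite rmorph_sum big_seq /=; apply: (big_ind (lincomb _ _)).
- exact: lincomb0.
- by move=> *; apply: lincombD.
move=> p pt; have /mapP[a + pa] := allP tX _ pt.
rewrite mem_monomials => /eqP ak.
have [b [c [abc bn]]] : exists b c, a = (b + c)%MM /\ mdeg b = n.
  by apply: mnm_split; rewrite ak.
rewrite rmorphM /= pa iota_mmap1 abc mmap1D [X b * _]mulrC mulrA.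
apply: lincomb_mem; last by apply: map_f; rewrite mem_monomials bn.
by rewrite filMr // -ak abc mdegD bn addKn mmap1_fil.
Qed.

Lemma fil_ideal_exp n : ideal_exp (fil 1 : idealr (completion I)) n =i fil n.
Proof.
move=> y; apply/idP/idP.
  apply: ideal_gen_min => a x /asboolP[t tF ->]; apply: filMr.
  elim: n t tF => // n IH t; case/tupleP: t => z t /= /andP[zF tF].
  by rewrite big_cons -add1n filM ?IH.
move=> /fil_gen; apply: ideal_gen_mono => _ /mapP[a + ->].
rewrite mem_monomials => /eqP <-.
apply: (mmap1_filtration (G := fun n => ideal_exp (fil 1 : idealr (completion I)) n)).
- exact: ideal_exp0.
- exact: ideal_expM.
by move=> i; apply/ideal_exp1/generator_fil.
Qed.

Lemma fil_ideal_ext : fil 1 =i ideal_ext iota I.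
Proof.
move=> y; apply/idP/idP; last first.
  apply: ideal_gen_min => z _ /asboolP[x xI ->].
  exact/filMr/fil_iota/ideal_exp1.
move=> /fil_gen; apply: ideal_gen_mono => _ /mapP[a + ->].
rewrite mem_monomials => /mdeg1P[i /eqP ->]; rewrite mmap1U.
by apply/ideal_gen_in/asboolP; exists s`_i; rewrite ?Is //; apply/ideal_gen_in/mem_nth.
Qed.

Lemma fil_adically_complete : adically_complete (fil 1 : idealr (completion I)).
Proof.
pose M : idealr (completion I) := fil 1.
have inj : injective (to_completion M).
  move=> y z yz; apply/eqP; rewrite -subr_eq0; apply/eqP/fil_separated => -[//|n].
  rewrite -fil_ideal_exp; apply/quot_exp_piP.
  exact: (congr1 (fun w : completion M => completion_proj w n) yz).
have surj (w : completion M) : exists y, to_completion M y = w.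
  have [v vP] := choice (fun n => quot_exp_pi_surj (completion_proj w n)).
  have vF n : v n.+1 - v n \in fil n.+1.
    rewrite -fil_ideal_exp; apply/quot_exp_piP.
    by rewrite -vP -quot_exp_trans_pi -vP completion_projP.
  (* The predecessor offsets the indexing: [v n] is determined modulo [fil n.+1]. *)
  have [|y yP] := @fil_limit (fun n => v n.-1) => [[|n]|]; rewrite ?vF //.
  exists y; apply: completion_eq => n; rewrite vP; apply/quot_exp_piP.
  by rewrite fil_ideal_exp; apply: (yP n.+1).
have [g gK] := choice surj.
by exists g => // y; apply: inj; rewrite gK.
Qed.

(** * Initial monomials and Noetherianity *)

Definition above a : {pred completion I} := fun x =>
  `[< exists2 b, (mdeg b == mdeg a) && (a < b)%O & x = X b >].

(* [a] is the exponent of an initial monomial, for the filtration by degree     *)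
(* refined by the monomial order, of an element of J.                          *)
Definition initial (J : {pred completion I}) a (y : completion I) : Prop :=
  y \in J /\ exists2 h, h \in ideal_gen (above a) &
    y - X a - h \in fil (mdeg a).+1.

Lemma aboveM a b h : h \in ideal_gen (above a) ->
  X b * h \in ideal_gen (above (b + a)%MM).
Proof.
case/asboolP=> t ta ->; rewrite mulr_sumr big_seq; apply: rpred_sum => p pt.
have /asboolP[c /andP[/eqP ca ac] pc] := allP ta _ pt.
rewrite mulrCA; apply/ideal_genMr/ideal_gen_in/asboolP; exists (b + c)%MM.
  by rewrite !mdegD ca eqxx ltmc_add2r.
by rewrite pc mmap1D.
Qed.

Lemma completion_noetherian : maximal_ideal I -> noetherian (completion I).
Proof.
move=> Imax J; have [l lJ lP] := dickson (fun a => exists y, initial J a y).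
have /choice[f fP] a : exists y, a \in l -> initial J a y.
  have [/lJ[y ay]|al] := boolP (a \in l); first by exists y.
  by exists 0.
exists [seq f a | a <- l] => y; apply/idP/idP; last first.
  by apply: ideal_gen_sub => _ /mapP[a /fP[aJ _] ->].
move: y; apply: (fil_lift (n0 := \max_(a <- l) mdeg a)) => n.
set n0 := \max_(a <- l) mdeg a.
(* Induction on the monomials of degree n still to be cancelled: modulo [fil n.+1], [y] involves
   only those in [l2]. *)
suff reduce l2 l1 y h : l1 ++ l2 = monomials d n -> y \in J ->
    h \in ideal_gen (mem [seq X a | a <- l2]) -> y - h \in fil n.+1 ->
    exists z, [/\ lincomb (fil (n - n0)) [seq f a | a <- l] z,
                  y - z \in J & y - z \in fil n.+1].
  move=> y yJ /fil_gen yn.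
  by apply: (reduce (monomials d n) [::] y y); rewrite ?subrr ?rpred0.
elim: l2 l1 y h => [|a l2 IH] l1 y h lE yJ.
  move=> /ideal_gen_nil ->; rewrite subr0 => yF.
  by exists 0; rewrite subr0; split=> //; apply: lincomb0.
move=> /ideal_gen_cons[c hl] yh.
have {hl} [h' hE hl] : exists2 h', h = c * X a + h' &
    h' \in ideal_gen (mem [seq X b | b <- l2]).
  by exists (h - c * X a); rewrite // addrC subrK.
have lE' : rcons l1 a ++ l2 = monomials d n by rewrite cat_rcons.
have an : mdeg a = n.
  by apply/eqP; rewrite -mem_monomials -lE mem_cat mem_head orbT.
(* If [c] is in [fil 1], the term c X^a already has order n + 1 and is dropped; otherwise [c] is a
   unit. *)
have [cF|/(fil_inv Imax)[c' c'c]] := boolP (c \in fil 1).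
  apply: (IH _ _ h' lE') => //.
  have -> : y - h' = y - h + c * X a by rewrite hE; ring.
  by rewrite rpredD // -add1n filM // -an mmap1_fil.
have := sorted_monomials d n; rewrite -lE (sorted_pairwise lt_trans) pairwise_cat.
rewrite allrel_consr => /and3P[/andP[l1a _] _ /= /andP[al2 _]].
have l2_above b : b \in l2 -> X b \in above a.
  move=> bl2; apply/asboolP; exists b => //; rewrite (allP al2) // an andbT.
  by rewrite -mem_monomials -lE mem_cat inE bl2 !orbT.
(* Since the list is sorted, monomials of degree n greater than a are exactly those of [l2]. *)
have above_l2 : {subset above a <= mem [seq X b | b <- l2]}.
  move=> _ /asboolP[b /andP[ba ab] ->]; apply: map_f.
  have : b \in monomials d n by rewrite mem_monomials -an.
  rewrite -lE mem_cat inE => /or3P[/(allP l1a)|/eqP ba'|//].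
    by move=> /(lt_trans ab); rewrite ltxx.
  by move: ab; rewrite ba' ltxx.
(* Dividing [y] by the unit [c] shows that a is an initial exponent of J. *)
have [b bl ba] : exists2 b, b \in l & (b <= a)%MM.
  apply: lP; exists (c' * y); split; first exact: idealMr.
  exists (c' * h').
    apply/ideal_genMr; apply: ideal_gen_mono hl => _ /mapP[b bl2 ->].
    exact/ideal_gen_in/l2_above.
  rewrite an; have -> : c' * y - X a - c' * h' = c' * (y - h).
    by rewrite hE !mulrBr mulrDr mulrA c'c mul1r opprD addrA.
  exact: filMr.
have [fJ [h0 h0b fF]] := fP _ bl.
pose e := (a - b)%MM; have eb : (e + b)%MM = a by apply: submK.
(* Subtracting [z] cancels c X^a and, by [aboveM], brings in only monomials of [l2] modulo
   [fil n.+1]. *)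
pose z := c * X e * f b.
have [z' [z'l z'J z'F]] : exists z', [/\ lincomb (fil (n - n0)) [seq f a | a <- l] z',
    y - z - z' \in J & y - z - z' \in fil n.+1].
  apply: (IH _ _ (h' - c * (X e * h0)) lE').
  - by rewrite rpredB // idealMr.
  - rewrite rpredB //; apply/ideal_genMr.
    apply: ideal_gen_mono (aboveM e h0b) => x; rewrite eb => /above_l2.
    exact: ideal_gen_in.
  have -> : y - z - (h' - c * (X e * h0)) = (y - h) - c * (X e * (f b - X b - h0)).
    have Xa : X a = X e * X b by rewrite -mmap1D eb.
    by rewrite /z hE Xa; ring.
  by rewrite rpredB // filMr // -an -eb mdegD -addnS filM ?mmap1_fil.
exists (z + z'); rewrite opprD addrA; split=> //; apply: lincombD => //.
apply: lincomb_mem; last exact: map_f.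
apply: filMr; apply: fil_le (mmap1_fil e).
(* The degree of [e] is n - deg b, at least n - n0 by the choice of [n0]. *)
by rewrite leq_subLR -an -eb mdegD addnC leq_add2r leq_bigmax_seq.
Qed.

End Generators.
End Filtration.

Theorem theorem2p2 (R : comNzRingType) (m : idealr R) :
  local_ring m -> finite_embedding_dimension m ->
  exists M : idealr (completion m),
    [/\ M =i ideal_ext (@to_completion R m) m,
        local_ring M,
        noetherian (completion m) &
        adically_complete M].
Proof.
move=> [mmax _] [_ [[s _ ms] _]]; exists (fil 1); split.
- exact: fil_ideal_ext ms.
- exact: fil_local_ring.
- exact: completion_noetherian ms mmax.
- exact: fil_adically_complete ms.
Qed.
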